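(* Let $H_{12}=\langle10,46\rangle\leq(\mathbb Z/333\mathbb Z)^\times$ be the subgroup generated by the residues $10$ and $46$ modulo $333$. There is no $H_{12}$-invariant Legendre pair of length $333$.
   Context: Sequence indices are taken modulo the sequence length. For a real sequence $x=(x_0,\dots,x_{L-1})$, its periodic autocorrelation is $\operatorname{PAF}_x(s)=\sum_{j=0}^{L-1}x_jx_{j+s}$. For odd $L$, two sequences $a,b\in\{\pm1\}^L$ form a Legendre pair (of length $L$) if $\operatorname{PAF}_a(s)+\operatorname{PAF}_b(s)=-2$ for all $1\le s<L$. For $H\leq(\mathbb Z/L\mathbb Z)^\times$, a sequence $x$ indexed by $\mathbb Z_L$ is $H$-invariant if $x_{hi}=x_i$ for all $h\in H$ and $i\in\mathbb Z_L$. A Legendre pair is $H$-invariant if both of its sequences are $H$-invariant. *)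

(* Defs.v *)
From HB Require Import structures.
From mathcomp Require Import all_boot all_order all_algebra all_fingroup.

Set Implicit Arguments.
Unset Strict Implicit.
Unset Printing Implicit Defensive.

Import Order.TTheory GRing.Theory Num.Theory.
Local Open Scope ring_scope.

(* A sequence of length L is a finite function on 'Z_L, so
   that indices are taken modulo L.  'Z_L is Z/LZ only for 1 < L: the
   definitions below are not meant for L = 1. *)

Definition paf (R : realFieldType) (L : nat) (x : {ffun 'Z_L -> R}) (s : 'Z_L) : R :=
  \sum_(j : 'Z_L) x j * x (j + s).

Definition pm1_seq (R : realFieldType) (L : nat) (x : {ffun 'Z_L -> R}) : Prop :=
  forall i : 'Z_L, x i = 1 \/ x i = -1.

(* The residues s with 1 <= s < L are the nonzero elements of 'Z_L. *)
Definition legendre_pair (R : realFieldType) (L : nat)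
    (a b : {ffun 'Z_L -> R}) : Prop :=
  [/\ odd L, pm1_seq a, pm1_seq b &
      forall s : 'Z_L, s != 0 -> paf a s + paf b s = - 2%:R].

Definition invariant_seq (R : realFieldType) (L : nat)
    (H : {group {unit 'Z_L}}) (x : {ffun 'Z_L -> R}) : Prop :=
  forall h : {unit 'Z_L}, h \in H -> forall i : 'Z_L, x (val h * i) = x i.

Definition invariant_legendre_pair (R : realFieldType) (L : nat)
    (H : {group {unit 'Z_L}}) (a b : {ffun 'Z_L -> R}) : Prop :=
  [/\ legendre_pair a b, invariant_seq H a & invariant_seq H b].

Fact unit10 : (10%:R : 'Z_333) \is a GRing.unit.
Proof. by rewrite unitZpE. Qed.

Fact unit46 : (46%:R : 'Z_333) \is a GRing.unit.
Proof. by rewrite unitZpE. Qed.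

Definition u10 : {unit 'Z_333} := FinRing.unit 'Z_333 unit10.
Definition u46 : {unit 'Z_333} := FinRing.unit 'Z_333 unit46.

Definition H12 : {group {unit 'Z_333}} := <<[set u10; u46]>>%G.

(* Main.v *)
(** Each entry of the 9-compression [A] of an invariant sequence (the sums over
    the classes modulo 9) is [e + 9 (x1 + x2 + x3 + x4)] with signs [e], [xi]:
    on a class, multiplication by 46 has one fixed point and four orbits of
    length 9.  Hence its square is 1 or at least 289.  A Legendre pair would
    give compressions with [PAF_A 0 + PAF_B 0 = 594 = 16 * 1 + 2 * 289] and
    [PAF_A s + PAF_B s = -74] for [s <> 0], so that [(sum A)^2 + (sum B)^2 = 2].
    A sequence with exactly one large entry has a sum of size at least
    17 - 8 = 9, so both large entries are [A_p] and [A_q], say; but then the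
    shift by [q - p] contradicts the value -74. *)

Require Import Defs.
From mathcomp Require Import all_boot all_order all_algebra all_fingroup.
From mathcomp Require Import ring lra.

Import Order.TTheory GRing.Theory Num.Theory.
Local Open Scope ring_scope.

Section PeriodicAutocorrelation.
Variables (R : realFieldType) (L : nat).
Implicit Types (x : {ffun 'Z_L -> R}) (s : 'Z_L).

Lemma sum_paf x : \sum_s paf x s = (\sum_i x i) ^+ 2.
Proof.
rewrite exchange_big expr2 mulr_suml; apply: eq_bigr => j _ /=.
by rewrite -mulr_sumr [in RHS](reindex_inj (addrI j)).
Qed.

Lemma paf0 x : paf x 0 = \sum_i x i ^+ 2.
Proof. by apply: eq_bigr => i _; rewrite addr0 expr2. Qed.

(** With [c] a sign, the nonnegative left side turns prescribed values of [paf] into upper bounds on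
    any few of its squares. *)
Lemma sum_sqr_shift x (c : R) s : c ^+ 2 = 1 ->
  \sum_i (x i + c * x (i + s)) ^+ 2 = 2 * paf x 0 + 2 * c * paf x s.
Proof.
move=> c1; have shift : \sum_i x (i + s) ^+ 2 = paf x 0.
  by rewrite paf0 [in RHS](reindex_inj (addIr s)).
transitivity (paf x 0 + 2 * c * paf x s + \sum_i x (i + s) ^+ 2); last first.
  by rewrite shift; ring.
rewrite paf0 mulr_sumr -!big_split; apply: eq_bigr => i _ /=.
by rewrite sqrrD exprMn c1; ring.
Qed.

Definition compress {m} (rho : 'Z_L -> 'Z_m) x : {ffun 'Z_m -> R} :=
  [ffun j => \sum_(z | rho z == j) x z].

(** For [z] in the class [j], the points [z + t] with [rho t = s] run over the class [j + s]. *)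
Lemma paf_compress m (rho : 'Z_L -> 'Z_m) x (s : 'Z_m) :
  {morph rho : z w / z + w} ->
  paf (compress rho x) s = \sum_(t | rho t == s) paf x t.
Proof.
move=> rhoD; rewrite [RHS]exchange_big /=.
rewrite [RHS](partition_big rho predT) //=; apply: eq_bigr => j _.
rewrite !ffunE mulr_suml; apply: eq_bigr => z /eqP zj.
rewrite -mulr_sumr (reindex_inj (addrI z)); congr (_ * _).
by apply: eq_bigl => t; rewrite rhoD zj (inj_eq (addrI j)).
Qed.

End PeriodicAutocorrelation.

Arguments compress {R L m} rho x.

Section LargeEntries.
Variables (R : realFieldType) (A B : {ffun 'Z_9 -> R}).
Hypothesis A_dich : forall i, A i ^+ 2 = 1 \/ 289 <= A i ^+ 2.
Hypothesis B_dich : forall i, B i ^+ 2 = 1 \/ 289 <= B i ^+ 2.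
Hypothesis energy : paf A 0 + paf B 0 = 594.
Hypothesis pafAB : forall s, s != 0 -> paf A s + paf B s = - 74.

Lemma sum_sqrD : (\sum_i A i) ^+ 2 + (\sum_i B i) ^+ 2 = 2.
Proof.
rewrite -!sum_paf -big_split (bigD1 0) //= energy.
rewrite (eq_bigr (fun=> - 74)) => [|s /pafAB//].
rewrite sumr_const (_ : #|_| = 8%N); first by rewrite -mulr_natr; lra.
by have := cardC1 (0 : 'Z_9); rewrite card_ord.
Qed.

Lemma two_large p : 289 <= A p ^+ 2 -> exists2 q, q != p & 289 <= A q ^+ 2.
Proof.
move=> Ap; have [/existsP[q /andP[]]|] :=
  boolP [exists q, (q != p) && (289 <= A q ^+ 2)]; first by exists q.
rewrite negb_exists => /forallP small; exfalso.
have A1 q : q != p -> `|A q| <= 1.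
  move=> qp; have := small q; rewrite qp /= => Aq.
  case: (A_dich q) => [Aq1|]; last by rewrite (negPf Aq).
  by rewrite -(ler_pXn2r (n := 2)) ?nnegrE // real_normK ?num_real // expr1n Aq1.
have rest : `|\sum_(q | q != p) A q| <= 8.
  apply: le_trans (ler_norm_sum _ _ _) _.
  apply: le_trans (ler_sum _ A1) _; rewrite sumr_const.
  by have := cardC1 p; rewrite card_ord => ->.
have := sum_sqrD; rewrite (bigD1 p) //=.
move: rest; set r := \sum_(_ | _) _; set b := \sum_i _.
rewrite ler_norml => /andP[r1 r2].
have [] : 17 <= A p \/ A p <= - 17 by case: (lerP 0 (A p)) => ?; [left|right]; nra.
  by move=> ? ?; nra.
by move=> ? ?; nra.
Qed.

Lemma A_small p : A p ^+ 2 = 1.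
Proof.
case: (A_dich p) => // Ap; exfalso; have [q qp Aq] := two_large p Ap.
have ge1 (i : 'Z_9) : 1 <= A i ^+ 2 by case: (A_dich i) => ?; lra.
(* The energy of [B] is at least 9, which leaves 585 = 9 + 2 * 288 for [A]: the excesses at [p] and
   [q] already exhaust this. *)
have excess (x : {ffun 'Z_9 -> R}) : paf x 0 = 9 + \sum_i (x i ^+ 2 - 1).
  by rewrite sumrB -paf0 sumr_const card_ord addrC subrK.
have B0 : 9 <= paf B 0.
  by rewrite excess lerDl sumr_ge0 // => i _; case: (B_dich i) => ?; lra.
have s0 : q - p != 0 by rewrite subr_eq0.
(* Here 2 is invertible modulo 9, with inverse 5. *)
have rp : q + (q - p) != p.
  have odd9 (d : 'Z_9) : d != 0 -> d + d != 0.
    apply: contra_neq => dd0.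
    rewrite -[d]mulr1 (_ : 1 = 2%:R * 5%:R); last exact/eqP.
    by rewrite mulrA [d * _]mulr_natr mulr2n dd0 mul0r.
  by have := odd9 _ s0; rewrite addrAC subr_eq0.
have rq : q + (q - p) != q by rewrite -subr_eq0 addrC addKr.
have ps : p + (q - p) = q by rewrite addrC subrK.
set r := q + (q - p) in rp rq.
have [Apq Ar] : A p ^+ 2 + A q ^+ 2 <= 578 /\ A r ^+ 2 = 1.
  have : paf A 0 <= 585.
    by move: energy B0; move: (paf A 0) (paf B 0) => ? ?; lra.
  rewrite excess (bigD1 p) // (bigD1 q) //= (bigD1 r) /=; last by rewrite rp.
  set S := \sum_(_ | _) _; have : 0 <= S.
    by apply: sumr_ge0 => i _; have := ge1 i; lra.
  by case: (A_dich r) => Ar S0 paf585; [split|]; lra.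
(* Add [sum_sqr_shift] for [A] and [B] at the shift [q - p], where 1188 = 2 * 594 and 148 = 2 * 74,
   and keep only the terms of [A] at [p] and [q]. *)
have bound c : c ^+ 2 = 1 ->
    (A p + c * A q) ^+ 2 + (A q + c * A r) ^+ 2 <= 1188 - 148 * c.
  move=> c1.
  have shift_ge0 (x : {ffun 'Z_9 -> R}) (P : pred 'Z_9) :
      0 <= \sum_(i | P i) (x i + c * x (i + (q - p))) ^+ 2.
    by apply: sumr_ge0 => i _; exact: sqr_ge0.
  have := shift_ge0 B predT; rewrite sum_sqr_shift //= => Bge0.
  have := sum_sqr_shift _ _ A c (q - p) c1.
  rewrite (bigD1 p) // (bigD1 q) //= ps -/r.
  have := shift_ge0 A (fun i => (i != p) && (i != q)).
  have := congr1 ( *%R c) (pafAB _ s0); rewrite mulrDr.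
  move: energy Bge0; set S := \sum_(_ | _) _.
  move: (paf A 0) (paf B 0) (paf A _) (paf B _) S (A p) (A q) (A r).
  by move=> *; lra.
(* Both squares are 289. If [A p = A q], then [c = 1] gives 4 * 289 = 1156 > 1040. If [A p = - A q],
   then [c = -1] gives at least 1156 + (17 - 1)^2 = 1412 > 1336. *)
have /eqP : A p ^+ 2 = A q ^+ 2 by lra.
rewrite eqf_sqr => /orP[] /eqP Ap_q.
  by have := bound 1 (expr1n _ _); rewrite Ap_q; nra.
have /bound : (-1) ^+ 2 = 1 :> R by rewrite sqrrN expr1n.
rewrite Ap_q.
have : (A q * A r) ^+ 2 = 289 by rewrite exprMn Ar; lra.
by nra.
Qed.

End LargeEntries.

(** By symmetry [A_small] also applies to [B], so the energy would be 18. *)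
Lemma compressed_pair_false (R : realFieldType) (A B : {ffun 'Z_9 -> R}) :
  (forall i, A i ^+ 2 = 1 \/ 289 <= A i ^+ 2) ->
  (forall i, B i ^+ 2 = 1 \/ 289 <= B i ^+ 2) ->
  paf A 0 + paf B 0 = 594 ->
  (forall s, s != 0 -> paf A s + paf B s = - 74) -> False.
Proof.
move=> dA dB energy pafAB.
have A1 := A_small R A B dA dB energy pafAB.
have B1 : forall i, B i ^+ 2 = 1.
  by apply: (A_small R B A dB dA) => [|s /pafAB]; rewrite addrC.
move: energy; rewrite !paf0.
rewrite (eq_bigr _ (fun i _ => A1 i)) (eq_bigr _ (fun i _ => B1 i)).
by rewrite !sumr_const card_ord -natrD => /eqP; rewrite eqr_nat.
Qed.

Definition mod9 (z : 'Z_333) : 'Z_9 := inZp z.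

Lemma mod9D : {morph mod9 : z w / z + w}.
Proof.
move=> z w; apply: val_inj => /=.
by rewrite modn_dvdm // modnDm.
Qed.

(* The fixed point of multiplication by 46 in the class of [j] modulo 9 is
   [37 j]; 2 generates the units modulo 37, and 46 = 9 generates the fourth
   powers, whence the orbit representatives [37 j + 9 * 2 ^ t]. *)
Lemma sum_mod9 (R : nmodType) (F : 'Z_333 -> R) (j : 'Z_9) :
  \sum_(z | mod9 z == j) F z =
  F (37 * j)%:R +
  \sum_(t < 4) \sum_(n < 9) F (46%:R ^+ n * (37 * j + 9 * 2 ^ t)%:R).
Proof.
(* Both sides become sums over lists of natural numbers below 333; a computation for each of the
   nine [j] shows that the lists are permutations of each other. *)
pose G n := F n%:R.
pose step n := (46 * n %% 333)%N.
have iter_step n z : (iter n step z)%:R = 46%:R ^+ n * z%:R :> 'Z_333.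
  elim: n => [|n IHn] /=; first by rewrite mul1r.
  by rewrite Zp_nat_mod // natrM IHn exprS mulrA.
have -> : \sum_(z | mod9 z == j) F z =
    \sum_(z <- [seq z <- iota 0 333 | (z %% 9 == j)%N]) G z.
  rewrite big_filter -[iota 0 333]/(index_iota 0 333) big_mkord.
  by apply: eq_big => [z|z _]; rewrite /G ?natr_Zp.
have -> : F (37 * j)%:R + \sum_(t < 4) \sum_(n < 9)
      F (46%:R ^+ n * (37 * j + 9 * 2 ^ t)%:R) =
    \sum_(z <- (37 * j)%N :: [seq iter n step ((37 * j + 9 * 2 ^ t) %% 333)%N
                                | t <- iota 0 4, n <- iota 0 9]) G z.
  rewrite big_cons big_allpairs_dep /G; congr (_ + _).
  rewrite -[iota 0 4]/(index_iota 0 4) big_mkord; apply: eq_bigr => t _.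
  rewrite -[iota 0 9]/(index_iota 0 9) big_mkord; apply: eq_bigr => n _.
  by rewrite iter_step Zp_nat_mod.
by apply: perm_big; case: j => -[|[|[|[|[|[|[|[|[|//]]]]]]]]] ?; vm_compute.
Qed.

Lemma u46_H12 : u46 \in H12.
Proof. by apply: mem_gen; rewrite !inE eqxx orbT. Qed.

Lemma compress_dich (R : realFieldType) (x : {ffun 'Z_333 -> R}) (j : 'Z_9) :
  pm1_seq x -> invariant_seq H12 x ->
  compress mod9 x j ^+ 2 = 1 \/ 289 <= compress mod9 x j ^+ 2.
Proof.
move=> x1 xH; rewrite ffunE sum_mod9.
have x46 n i : x (46%:R ^+ n * i) = x i.
  elim: n => [|n IHn]; first by rewrite mul1r.
  by rewrite exprS -mulrA (xH u46 u46_H12).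
pose e i : R := x (37 * j + i)%:R.
have e1 i : e i = 1 \/ e i = -1 by exact: x1.
rewrite (eq_bigr (fun t : 'I_4 => 9 * e (9 * 2 ^ t)%N)) => [|t _]; last first.
  rewrite (eq_bigr (fun=> e (9 * 2 ^ t)%N)) => [|n _]; last exact: x46.
  by rewrite sumr_const card_ord mulr_natl.
have -> : x (37 * j)%:R = e 0%N by rewrite /e addn0.
rewrite !big_ord_recl big_ord0 addr0 /=.
(* A sum of four signs is even: if it is 0 the entry is a sign, otherwise its size is at least 9 * 2
   - 1 = 17. *)
repeat match goal with |- context [e ?i] => case: (e1 i) => -> end;
  first [by left; lra | by right; lra].
Qed.

Theorem theorem2 (R : realFieldType) :
  ~ (exists a b : {ffun 'Z_333 -> R}, invariant_legendre_pair H12 a b).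
Proof.
case=> a [b [[_ a1 b1 pafab] aH bH]].
have paf_ab s : paf (compress mod9 a) s + paf (compress mod9 b) s =
    \sum_(t | mod9 t == s) (paf a t + paf b t).
  by rewrite !paf_compress ?big_split //; exact: mod9D.
have pm1_paf0 (x : {ffun 'Z_333 -> R}) : pm1_seq x -> paf x 0 = 333.
  move=> x1; rewrite paf0 (eq_bigr (fun=> 1)) ?sumr_const ?card_ord // => i _.
  by case: (x1 i) => ->; lra.
(* [sum_mod9] on a constant counts the class: 1 + 4 * 9 = 37 elements. *)
have fibre (s : 'Z_9) : \sum_(t | mod9 t == s) (- 2%:R : R) = - 74.
  by rewrite sum_mod9 !sumr_const !card_ord; lra.
apply: (@compressed_pair_false R (compress mod9 a) (compress mod9 b)).
- by move=> j; exact: compress_dich.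
- by move=> j; exact: compress_dich.
(* The term [t = 0] is 2 * 333 and the 36 others are -2, so the sum is 666 - 72 = 594. *)
- rewrite paf_ab (bigD1 0) //= !pm1_paf0 // (eq_bigr (fun=> - 2%:R)) => [|t].
    by have := fibre 0; rewrite (bigD1 0) //=; set S := \sum_(_ | _) _; lra.
  by case/andP => _ /pafab.
- move=> s s0; rewrite paf_ab -(fibre s); apply: eq_bigr => t /eqP ts.
  by apply: pafab; apply: contraNneq s0 => t0; rewrite -ts t0.
Qed.
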